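(* There exists a $B_2[2]$ sequence $A$ of positive integers which is an asymptotic basis of order $3$.
   Context: A sequence (set) $A$ of positive integers is a $B_2[g]$ sequence if every integer $n$ has at most $g$ representations of the form $n=a+a'$ with $a\le a'$, $a,a'\in A$. A set $A$ of positive integers is an asymptotic basis of order $h$ if every sufficiently large positive integer $n$ can be written as a sum of $h$ (not necessarily distinct) elements of $A$. *)

(* Defs.v *)
From mathcomp Require Import all_boot.
From mathcomp Require Import boolp classical_sets functions cardinality.

Set Implicit Arguments.
Unset Strict Implicit.
Unset Printing Implicit Defensive.

Local Open Scope nat_scope.
Local Open Scope classical_set_scope.
Local Open Scope card_scope.

Definition positive_integers : set nat := [set n | 0 < n].

Definition representations (A : set nat) (n : nat) : set (nat * nat) :=
  [set p | [/\ A p.1, A p.2, p.1 <= p.2 & n = p.1 + p.2]].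

(* [`I_g] is the set of the naturals less than [g], so [S #<= `I_g] says that
   [S] has at most [g] elements. Integers [n < 0] have no representation as a
   sum of naturals, hence [n] ranges over [nat]. *)
Definition B2 (g : nat) (A : set nat) : Prop :=
  forall n : nat, representations A n #<= `I_g.

Definition sum_of (h : nat) (A : set nat) (n : nat) : Prop :=
  exists a : 'I_h -> nat, (forall i, A (a i)) /\ n = \sum_(i < h) a i.

Definition asymptotic_basis (h : nat) (A : set nat) : Prop :=
  exists N : nat, forall n : nat, N <= n -> sum_of h A n.

(* Main.v *)
Require Import Defs.
From mathcomp Require Import all_boot all_order all_algebra.
From mathcomp Require Import boolp classical_sets functions cardinality.
From mathcomp Require Import zify lra.

(** The set is built greedily, in stages, and nothing is random: a potential
    function replaces every probabilistic estimate.

    At a stage with parameter [q], a finite set [A0] is enlarged by [q ^ 21]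
    integers [w < X = q ^ 60], added one at a time, so that all targets [n]
    between [(q / 2) ^ 60] and [q ^ 60] become sums [w + u + v], where [u], [v]
    belong to the core [C], a part of [A0] which is fixed during the stage and
    has at least [(q / 4) ^ 21] elements.  The next stage uses [2 * q].  All
    the sets have size [m] just above the cube root of the range, so that an
    integer has on average only [m ^ 3 / X], about [q ^ 3], representations as
    a sum of three elements.

    Let [sums2 A n] count the ordered pairs of [A] with sum [n].  Having at most
    two unordered representations follows from [sums2 A n <= 4]
    ([admissible]); call [n] rich when [2 < sums2 A n].  Adding [w] keeps [A]
    admissible unless [w + a] is rich for some [a] in [w :: A]; such a [w] is
    forbidden.  The [w] that cover a target [n] are the [n - (u + v)], at least
    [|C| ^ 2 / 4] of them, and the forbidden ones among these give solutions of
    [n + a = (u + v) + d] with [d] rich.  For a fixed left-hand side their number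
    is [rich_shifts A (n + a)], so at most [m * max rich_shifts] covering [w]
    are lost, which is negligible against [|C| ^ 2] as soon as [rich_shifts]
    stays below a small power of [q] ([hits_lower]).

    It remains to choose the [w] so that [rich_shifts] stays small.  One new
    element raises [rich_shifts A N] by at most a few times the largest
    [sums3 A n], the number of representations as a sum of three elements, and
    it raises [sums3 A n] by at most 16, because what a new representation
    contains besides the new element is counted by [sums2 A].  The sums of these
    increments over all candidates [w] are small ([sums3_inc_sum],
    [rich_shifts_inc_sum]), and so is that of [rich_pairs], which bounds the
    number of rich integers and hence of forbidden [w].  So three families of
    counters have bounded increments with small means, and every uncovered
    target is covered by a fixed proportion of the allowed [w].  Add the
    exponentials of the counters to weights of the uncovered targets that decay
    with each step: some [w] keeps this sum below 1, as its mean over [w] does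
    not increase; this is the lemma [greedy].  At the end of the stage no target
    is uncovered and every counter is bounded.

    The union of the increasing chain of finite sets has the two properties,
    since each of them concerns, for a given integer, a finite part of the set
    only. *)

Set Implicit Arguments.
Unset Strict Implicit.
Unset Printing Implicit Defensive.

(** * Choosing elements one at a time by a potential function *)

Section Potential.

Import Order.TTheory GRing.Theory Num.Theory.
Local Open Scope ring_scope.

Lemma bernoulli (x : rat) n : -1 <= x -> 1 + n%:R * x <= (1 + x) ^+ n.
Proof.
move=> x_ge; elim: n => [|n IHn]; first by rewrite expr0 mul0r addr0.
have x1_ge0 : 0 <= 1 + x by lra.
rewrite exprS; apply: le_trans (ler_wpM2l x1_ge0 IHn).
have : 0 <= n%:R * (x * x) by rewrite mulr_ge0 ?ler0n // -expr2 sqr_ge0.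
rewrite -natr1; nra.
Qed.

(** Since [(1 + x) * (1 - x) <= 1], Bernoulli for [1 - x] bounds the growth of
    [1 + x]; symmetrically below, it bounds the decay of [1 - x]. *)
Lemma expr_1D_le2 (x : rat) p : 0 <= x -> 2 * p%:R * x <= 1 -> (1 + x) ^+ p <= 2.
Proof.
case: p => [|p] x_ge0 px; first by rewrite expr0.
have x_le1 : x <= 1.
  have : 1 * x <= p.+1%:R * x by rewrite ler_wpM2r // ler1n.
  lra.
have half : 1 / 2 <= (1 - x) ^+ p.+1.
  have x_ge : -1 <= - x by lra.
  apply: le_trans (bernoulli _ x_ge); lra.
have prod1 : (1 + x) ^+ p.+1 * (1 - x) ^+ p.+1 <= 1.
  rewrite -exprMn; apply: exprn_ile1; nra.
have pos : 0 <= (1 + x) ^+ p.+1 by apply: exprn_ge0; lra.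
nra.
Qed.

Lemma expr_1B_le_half (x : rat) p :
  0 <= x <= 1 -> 1 <= p%:R * x -> (1 - x) ^+ p <= 1 / 2.
Proof.
move=> /andP[x_ge0 x_le1] px.
have two : 2 <= (1 + x) ^+ p.
  have x_ge : -1 <= x by lra.
  apply: le_trans (bernoulli _ x_ge); lra.
have prod1 : (1 + x) ^+ p * (1 - x) ^+ p <= 1.
  rewrite -exprMn; apply: exprn_ile1; nra.
have pos : 0 <= (1 - x) ^+ p by apply: exprn_ge0; lra.
nra.
Qed.

(** The convexity estimate that turns a mean increment of a counter into a mean
    factor of its exponential. *)
Lemma expr_1D_inv_le (y d : nat) :
  (0 < y)%N -> (2 * d <= y)%N -> (1 + y%:R^-1) ^+ d <= 1 + 2 * d%:R / y%:R :> rat.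
Proof.
move=> y_gt0; have y0 : 0 < y%:R :> rat by rewrite ltr0n.
have iy0 : 0 < y%:R^-1 :> rat by rewrite invr_gt0.
elim: d => [|d IHd] dy; first by rewrite expr0 mulr0 mul0r addr0.
have IH := IHd ltac:(lia).
have d_le : 2 * d%:R / y%:R <= 1 :> rat.
  by rewrite ler_pdivrMr // mul1r -natrM ler_nat; lia.
rewrite exprSr -natr1; set z := y%:R^-1 in iy0 IH d_le *.
have : (1 + z) ^+ d * (1 + z) <= (1 + 2 * d%:R * z) * (1 + z).
  by rewrite ler_wpM2r //; lra.
have : 2 * d%:R * z * z <= 1 * z by rewrite ler_wpM2r //; lra.
lra.
Qed.

Lemma averaging (G : seq nat) (F : nat -> rat) (c : rat) :
  (0 < size G)%N -> \sum_(w <- G) F w <= (size G)%:R * c ->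
  exists2 w, w \in G & F w <= c.
Proof.
elim: G => [//|w G IHG] _; rewrite big_cons /= -natr1 mulrDl mul1r => sum_le.
have [Fw|Fw] := leP (F w) c; first by exists w; rewrite ?mem_head.
have [G0|G_gt0] := posnP (size G).
  by move: sum_le; rewrite (size0nil G0) big_nil /= mul0r; lra.
have [||w' w'G Fw'] := IHG; [done|lra|].
by exists w'; rewrite // inE w'G orbT.
Qed.

Lemma sum_le_const (I : eqType) (s : seq I) (F : I -> rat) (c : rat) :
  (forall i, i \in s -> F i <= c) -> \sum_(i <- s) F i <= (size s)%:R * c.
Proof.
move=> F_le; rewrite big_seq; apply: le_trans (ler_sum _ F_le) _.
by rewrite -big_seq big_const_seq count_predT iter_addr_0 mulr_natl.
Qed.

Section Greedy.

Variables (J : eqType) (js : seq J) (f : J -> seq nat -> nat) (y b : J -> nat).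
Variables (ns : seq nat) (hit : nat -> nat -> bool).
Variables (G : seq nat -> seq nat) (P : seq nat -> Prop) (A0 : seq nat).
Variables (h p p' r r' L : nat).

(** The bookkeeping is that of a conditional expectation: [m] is the number of
    elements still to be added; an unhit target weighs the probability that [m]
    random choices, each hitting it with probability [1 / p'], all miss it; and
    counter [j] weighs an exponential, with base [1 + 1 / y j], of its excess
    over [b j + h * y j], times a bound for the mean growth of this exponential
    in [m] steps.  A
    potential below 1 therefore keeps all counters below that threshold, and
    for [m = 0] leaves no target unhit. *)
Definition potential (A : seq nat) (m : nat) : rat :=
  \sum_(n <- ns) (~~ has (hit n) A)%:R * (1 - p'%:R^-1) ^+ m +
  \sum_(j <- js) (1 + (y j)%:R^-1) ^+ f j A
     / (1 + (y j)%:R^-1) ^+ (b j + h * y j)%N * (1 + (2 * p)%:R^-1) ^+ m.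

Hypothesis p_gt0 : (0 < p)%N.
Hypothesis p'_gt0 : (0 < p')%N.
Hypothesis y_gt0 : forall j, j \in js -> (0 < y j)%N.

Let base_gt0 j : 0 < 1 + (y j)%:R^-1 :> rat.
Proof. by rewrite ltr_pwDl // invr_ge0. Qed.

Let decay_ge0 : 0 <= 1 - p'%:R^-1 :> rat.
Proof. by rewrite subr_ge0 invf_le1 ?ler1n ?ltr0n. Qed.

Let growth_ge0 : 0 <= 1 + (2 * p)%:R^-1 :> rat.
Proof. by rewrite addr_ge0 // invr_ge0. Qed.

Lemma potential_counter A m j :
  j \in js -> potential A m < 1 -> (f j A <= b j + h * y j)%N.
Proof.
move=> j_js; rewrite leqNgt => pot_lt1; apply/negP => f_gt.
suff : 1 <= potential A m by rewrite leNgt pot_lt1.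
rewrite /potential (perm_big _ (perm_to_rem j_js)) big_cons addrCA.
rewrite ler_wpDr //; last first.
  rewrite -[leLHS]mulr1 ler_pM ?ler01 //.
    rewrite ler_pdivlMr ?exprn_gt0 // mul1r ler_weXn2l //; last exact: ltnW.
    by rewrite lerDl invr_ge0.
  by rewrite exprn_ege1 // lerDl invr_ge0.
rewrite addr_ge0 // sumr_ge0 // => i _; rewrite mulr_ge0 ?exprn_ge0 //.
by rewrite divr_ge0 ?exprn_ge0 // ltW.
Qed.

Lemma potential_hit A n : n \in ns -> potential A 0 < 1 -> has (hit n) A.
Proof.
move=> n_ns; apply: contraLR => unhit; rewrite -leNgt.
rewrite /potential (perm_big _ (perm_to_rem n_ns)) big_cons unhit expr0 mulr1.
rewrite -addrA ler_wpDr // addr_ge0 // sumr_ge0 // => i _.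
  by rewrite mulr_ge0 // ler0n.
by rewrite mulr_ge0 ?exprn_ge0 // divr_ge0 ?exprn_ge0 // ltW.
Qed.

(** Initially a target weighs at most [2 ^- r'] and a counter at most
    [2 ^ r / 2 ^ h]. *)
Lemma potential_init :
  L = (p * r)%N -> L = (p' * r')%N ->
  (forall j, j \in js -> f j A0 <= b j)%N ->
  (2 * size ns <= 2 ^ r')%N -> (2 * (size js * 2 ^ r) < 2 ^ h)%N ->
  potential A0 L < 1.
Proof.
move=> Lpr Lpr' f_le ns_le js_lt.
have two0 k : 0 < 2 ^+ k :> rat by rewrite exprn_gt0.
have half1 : \sum_(n <- ns) (~~ has (hit n) A0)%:R * (1 - p'%:R^-1) ^+ L
             <= (size ns)%:R / 2 ^+ r' :> rat.
  have term n : n \in ns -> (~~ has (hit n) A0)%:R * (1 - p'%:R^-1) ^+ L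
                        <= (2 ^+ r')^-1 :> rat.
    move=> _.
    apply: (@le_trans _ _ ((1 - p'%:R^-1) ^+ L)).
      by rewrite ler_piMl ?exprn_ge0 //; case: has.
    rewrite Lpr' exprM -exprVn lerXn2r ?nnegrE ?exprn_ge0 ?invr_ge0 //.
    rewrite -[leRHS]div1r; apply: expr_1B_le_half; last first.
      by rewrite mulfV // pnatr_eq0 -lt0n.
    by rewrite invr_ge0 ler0n -subr_ge0 decay_ge0.
  exact: sum_le_const.
have half2 : \sum_(j <- js) (1 + (y j)%:R^-1) ^+ f j A0
     / (1 + (y j)%:R^-1) ^+ (b j + h * y j)%N * (1 + (2 * p)%:R^-1) ^+ L
   <= (size js)%:R * (2 ^+ r / 2 ^+ h) :> rat.
  have term j : j \in js -> (1 + (y j)%:R^-1) ^+ f j A0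
     / (1 + (y j)%:R^-1) ^+ (b j + h * y j)%N * (1 + (2 * p)%:R^-1) ^+ L
     <= 2 ^+ r / 2 ^+ h :> rat.
    move=> jjs; rewrite mulrC; apply: ler_pM; rewrite ?exprn_ge0 //.
    - by rewrite divr_ge0 ?exprn_ge0 // ltW.
    - rewrite Lpr exprM lerXn2r ?nnegrE ?exprn_ge0 //.
      apply: expr_1D_le2; rewrite ?invr_ge0 // -natrM mulfV //.
      by rewrite pnatr_eq0 -lt0n muln_gt0.
    rewrite exprD invfM mulrA -[leRHS]mul1r ler_pM ?invr_ge0 ?exprn_ge0 //.
    + by rewrite divr_ge0 ?exprn_ge0 // ltW.
    + by rewrite ltW.
    + rewrite ler_pdivrMr ?exprn_gt0 // mul1r ler_weXn2l ?f_le //.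
      by rewrite lerDl invr_ge0.
    rewrite lef_pV2 ?posrE ?exprn_gt0 // mulnC exprM lerXn2r ?nnegrE ?exprn_ge0 //.
      by rewrite ltW.
    have y0 := y_gt0 jjs.
    have y_ge : -1 <= (y j)%:R^-1 :> rat by apply: le_trans (_ : 0 <= _); rewrite ?invr_ge0.
    apply: le_trans (bernoulli _ y_ge).
    by rewrite mulfV // pnatr_eq0 -lt0n.
  exact: sum_le_const.
apply: le_lt_trans (lerD half1 half2) _.
have h1 : (size ns)%:R / 2 ^+ r' <= 1 / 2 :> rat.
  by rewrite ler_pdivrMr // mulrAC mul1r ler_pdivlMr // -natrX -natrM ler_nat mulnC.
have h2 : (size js)%:R * (2 ^+ r / 2 ^+ h) < 1 / 2 :> rat.
  rewrite mulrA ltr_pdivrMr // mulrAC mul1r ltr_pdivlMr //.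
  by rewrite -!natrX -!natrM ltr_nat mulnC.
lra.
Qed.

Hypothesis step : forall A, P A -> (size A <= size A0 + L)%N ->
  (forall j, j \in js -> f j A <= b j + h * y j)%N ->
  [/\ (0 < size (G A))%N,
      forall w, w \in G A -> P (w :: A),
      forall j w, j \in js -> w \in G A -> (2 * (f j (w :: A) - f j A) <= y j)%N,
      forall j, j \in js ->
        (4 * p * (\sum_(w <- G A) (f j (w :: A) - f j A)) <= y j * size (G A))%N
    & forall n, n \in ns -> ~~ has (hit n) A ->
        (size (G A) <= p' * count (hit n) (G A))%N].

(** The mean of the potential over the available elements does not increase, so
    some element achieves it. *)
Lemma potential_step A m : P A -> (size A <= size A0 + L)%N ->
  potential A m.+1 < 1 ->
  exists2 w, P (w :: A) & potential (w :: A) m < 1.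
Proof.
move=> PA sizeA pot_lt1.
have [G_gt0 GP small_inc avg_inc avg_hit] :=
  step PA sizeA (fun j jjs => potential_counter jjs pot_lt1).
have [|w wG pot_w] := @averaging (G A) (fun w => potential (w :: A) m)
   (potential A m.+1) G_gt0; last first.
  by exists w; [exact: GP|exact: le_lt_trans pot_w _].
rewrite big_split /= mulrDr lerD //.
  rewrite exchange_big /= mulr_sumr big_seq [leRHS]big_seq ler_sum // => n n_ns.
  case: (boolP (has (hit n) A)) => [hitA|unhit].
    by rewrite mul0r mulr0 big1 // => w _; rewrite orbT mul0r.
  rewrite mul1r exprS mulrA -mulr_suml ler_wpM2r ?exprn_ge0 //.
  have -> : \sum_(w <- G A) (~~ (hit n w || false))%:R
            = (size (G A))%:R - (count (hit n) (G A))%:R :> rat.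
    rewrite -(count_predC (hit n) (G A)) natrD addrC addKr -sum1_count natr_sum.
    rewrite [RHS]big_mkcond; apply: eq_bigr => w _ /=.
    by rewrite orbF; case: hit.
  rewrite mulrBr mulr1 lerB // ler_pdivrMr ?ltr0n // mulrC -natrM ler_nat.
  exact: avg_hit.
rewrite exchange_big /= mulr_sumr big_seq [leRHS]big_seq ler_sum // => j jjs.
set z := 1 + (y j)%:R^-1; set c := z ^+ (b j + h * y j)%N.
have z_ge1 : 1 <= z by rewrite lerDl invr_ge0.
have c_gt0 : 0 < c by rewrite exprn_gt0 // base_gt0.
rewrite exprS -!mulr_suml !mulrA ler_wpM2r ?exprn_ge0 // mulrAC.
have c_inv : 0 <= c^-1 by rewrite invr_ge0 ltW.
have z_ge0 e : 0 <= z ^+ e by rewrite exprn_ge0 // (le_trans ler01).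
rewrite ler_wpM2r //.
apply: (@le_trans _ _ (\sum_(w <- G A) z ^+ f j A
          * (1 + 2 * (f j (w :: A) - f j A)%N%:R / (y j)%:R))).
  rewrite big_seq [leRHS]big_seq ler_sum // => w wG.
  apply: (@le_trans _ _ (z ^+ (f j A + (f j (w :: A) - f j A)))).
    by rewrite ler_weXn2l // -leq_subLR.
  rewrite exprD ler_wpM2l //.
  by rewrite expr_1D_inv_le ?y_gt0 ?small_inc.
rewrite -mulr_sumr [leRHS]mulrAC [leRHS]mulrC ler_wpM2l //.
rewrite big_split /= big_const_seq count_predT iter_addr_0 mulrDr mulr1 lerD //.
rewrite -mulr_suml -mulr_sumr -natr_sum ler_pdivrMr ?ltr0n ?y_gt0 //.
rewrite mulrAC ler_pdivlMr ?ltr0n ?muln_gt0 // -!natrM ler_nat.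
by have := avg_inc j jjs; lia.
Qed.

(** Derandomization: if at each step all counters have small increments with
    small mean over the available elements [G A], and each unhit target is hit
    by a fraction [1 / p'] of them, then [L] elements can be added so that
    every target is hit and no counter exceeds its threshold. *)
Lemma greedy :
  P A0 -> L = (p * r)%N -> L = (p' * r')%N ->
  (forall j, j \in js -> f j A0 <= b j)%N ->
  (2 * size ns <= 2 ^ r')%N -> (2 * (size js * 2 ^ r) < 2 ^ h)%N ->
  exists W, let A := W ++ A0 in
   [/\ size W = L, P A, (forall j, j \in js -> f j A <= b j + h * y j)%N
     & forall n, n \in ns -> has (hit n) A].
Proof.
move=> PA0 Lpr Lpr' f_le ns_le js_lt.
have pot0 := potential_init Lpr Lpr' f_le ns_le js_lt.
have : forall t, (t <= L)%N ->
    exists W, [/\ size W = t, P (W ++ A0) & potential (W ++ A0) (L - t) < 1].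
  elim=> [|t IHt] t_le; first by exists [::]; rewrite subn0.
  have [W [sizeW PW]] := IHt (ltnW t_le); rewrite -(subnSK t_le) => potW.
  have size_le : (size (W ++ A0) <= size A0 + L)%N.
    by rewrite size_cat sizeW addnC leq_add2l ltnW.
  have [w Pw potw] := potential_step PW size_le potW.
  by exists (w :: W); rewrite /= sizeW.
move=> /(_ L (leqnn L))[W [sizeW PW]]; rewrite subnn => potW.
exists W; split=> // [j jjs|n n_ns]; first exact: potential_counter potW.
exact: potential_hit potW.
Qed.

End Greedy.

End Potential.

(** * Counting representations *)

Definition sums2 (A : seq nat) (n : nat) : nat :=
  \sum_(a <- A) \sum_(b <- A) (a + b == n).

Definition sums3 (A : seq nat) (n : nat) : nat :=
  \sum_(c <- A) \sum_(a <- A) \sum_(b <- A) (c + (a + b) == n).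

Definition rich (A : seq nat) (n : nat) : bool := 2 < sums2 A n.

(** Each rich integer is counted once for each of its three or four ordered
    representations; this weighted count is additive over pairs, unlike the
    number of rich integers. *)
Definition rich_pairs (A : seq nat) : nat :=
  \sum_(a <- A) \sum_(b <- A) rich A (a + b).

(** When [u + v > N] the truncated difference is [0], which is not rich if the
    elements of [A] are positive. *)
Definition rich_shifts (A : seq nat) (N : nat) : nat :=
  \sum_(u <- A) \sum_(v <- A) rich A (N - (u + v)).

Definition admissible (A : seq nat) : Prop :=
  [/\ uniq A, 0 \notin A & forall n, sums2 A n <= 4].

Definition forbidden (A : seq nat) (w : nat) : bool :=
  has (fun a => rich A (w + a)) A || rich A (w + w).

Lemma leq_sum_seq (s : seq nat) (E1 E2 : nat -> nat) :
  {in s, forall i, E1 i <= E2 i} -> \sum_(i <- s) E1 i <= \sum_(i <- s) E2 i.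
Proof. by move=> le; rewrite big_seq [leqRHS]big_seq leq_sum. Qed.

Lemma sum_le_size (s : seq nat) (E : nat -> nat) c :
  {in s, forall i, E i <= c} -> \sum_(i <- s) E i <= size s * c.
Proof.
move=> le; apply: leq_trans (leq_sum_seq le) _.
by rewrite big_const_seq count_predT iter_addn_0 mulnC.
Qed.

Lemma leq_sum_subseq (s1 s2 : seq nat) (E : nat -> nat) :
  subseq s1 s2 -> \sum_(i <- s1) E i <= \sum_(i <- s2) E i.
Proof.
elim: s2 s1 => [|y s2 IHs] [|x s1] //= sub; rewrite ?big_nil ?big_cons //.
move: sub; case: eqP => [->|_] sub; first by rewrite leq_add2l IHs.
by have := IHs _ sub; rewrite big_cons => le; apply: leq_trans le _; rewrite leq_addl.
Qed.

Lemma sum_le1 (s : seq nat) (Q : pred nat) :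
  uniq s -> {in s &, forall i j, Q i -> Q j -> i = j} -> \sum_(i <- s) Q i <= 1.
Proof.
elim: s => [|x s IHs] /=; first by rewrite big_nil.
case/andP=> x_s uniq_s inj; rewrite big_cons.
case Qx: (Q x); last first.
  by apply: IHs => // i j is_ js; apply: inj; rewrite inE ?is_ ?js orbT.
rewrite big_seq big1 // => i is_; case Qi: (Q i) => //.
by move: x_s; rewrite (inj x i) ?mem_head ?inE ?is_ ?orbT.
Qed.

Lemma exchange_sum_le (s A : seq nat) (F : nat -> nat -> nat) c :
  {in A, forall a, \sum_(w <- s) F w a <= c} ->
  \sum_(w <- s) \sum_(a <- A) F w a <= size A * c.
Proof. by move=> le; rewrite exchange_big /= sum_le_size. Qed.

Lemma exchange_sum2_le (s A B : seq nat) (F : nat -> nat -> nat -> nat) c :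
  {in A & B, forall a b, \sum_(w <- s) F w a b <= c} ->
  \sum_(w <- s) \sum_(a <- A) \sum_(b <- B) F w a b <= size A * (size B * c).
Proof.
move=> le; apply: exchange_sum_le => a aA; apply: exchange_sum_le => b bB.
exact: le.
Qed.

Lemma sums2_subseq C A n : subseq C A -> sums2 C n <= sums2 A n.
Proof.
move=> CA; apply: leq_trans (leq_sum_subseq _ CA).
by apply: leq_sum => a _; exact: leq_sum_subseq.
Qed.

Lemma sums2_gt0 A n :
  reflect (exists a b, [/\ a \in A, b \in A & n = a + b]) (0 < sums2 A n).
Proof.
apply: (iffP idP) => [|[a [b [aA bA ->]]]]; last first.
  rewrite /sums2 (perm_big _ (perm_to_rem aA)) big_cons.
  by rewrite (perm_big _ (perm_to_rem bA)) big_cons eqxx.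
have [/hasP[a aA /hasP[b bA /eqP def_n]] _|none] :=
  boolP (has (fun a => has (fun b => a + b == n) A) A); first by exists a, b.
rewrite /sums2 big_seq big1 // => a /(hasPn none) /hasPn none_a.
by rewrite big_seq big1 // => b /none_a/negbTE->.
Qed.

Lemma sums2_cons w A n :
  sums2 (w :: A) n = sums2 A n + 2 * \sum_(a <- A) (w + a == n) + (w + w == n).
Proof.
rewrite /sums2 !big_cons.
under [X in _ + X]eq_bigr => a _ do rewrite big_cons.
rewrite big_split /=.
under [X in _ + (X + _)]eq_bigr => a _ do rewrite addnC.
lia.
Qed.

Lemma sums3_cons w A n :
  sums3 (w :: A) n = sums3 A n + 3 * \sum_(a <- A) \sum_(b <- A) (w + (a + b) == n)
    + 3 * \sum_(a <- A) (w + (w + a) == n) + (w + (w + w) == n).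
Proof.
have cons2 c : \sum_(a <- w :: A) \sum_(b <- w :: A) (c + (a + b) == n) =
  \sum_(a <- A) \sum_(b <- A) (c + (a + b) == n)
  + \sum_(a <- A) (c + (w + a) == n) + \sum_(a <- A) (c + (w + a) == n) + (c + (w + w) == n).
  rewrite !big_cons.
  under [X in _ + X]eq_bigr => a _ do rewrite big_cons.
  rewrite big_split /=.
  under [X in _ + (X + _)]eq_bigr => a _ do rewrite [a + w]addnC.
  lia.
rewrite /sums3 big_cons; under [X in _ + X]eq_bigr => c _ do rewrite cons2.
rewrite cons2 !big_split /=.
have -> : \sum_(c <- A) \sum_(a <- A) (c + (w + a) == n)
          = \sum_(a <- A) \sum_(b <- A) (w + (a + b) == n).
  by apply: eq_bigr => c _; apply: eq_bigr => a _; rewrite addnCA.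
have -> : \sum_(c <- A) (c + (w + w) == n) = \sum_(a <- A) (w + (w + a) == n).
  by apply: eq_bigr => c _; rewrite addnC -addnA.
lia.
Qed.

(** Bounds, after [w] has been added to [A], the event that [d] has become rich:
    then [d = w + x] for some [x], and [d] was already a sum of two elements. *)
Definition newly_rich (A : seq nat) (w d : nat) : nat :=
  \sum_(x <- w :: A) (w + x == d) * sums2 A d.

Section Counters.

Variable A : seq nat.
Hypothesis adm : admissible A.
Let m := size A.

Let uA : uniq A. Proof. by case: adm. Qed.
Let A_gt0 (a : nat) : a \in A -> 0 < a.
Proof. by case: adm => _ A0 _ aA; rewrite lt0n; apply: contraNneq A0 => <-. Qed.
Let A4 n : sums2 A n <= 4. Proof. by case: adm. Qed.

Lemma rich_le d : rich A d <= sums2 A d.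
Proof. by rewrite /rich; case: ltnP; lia. Qed.

Lemma shift_le1 (w n : nat) : \sum_(a <- A) (w + a == n) <= 1.
Proof.
apply: (@sum_le1 A (fun a : nat => w + a == n)) => // i j _ _ /eqP<-.
by rewrite eqn_add2l => /eqP.
Qed.

Lemma shift_double_eq0 (w : nat) : w \notin A -> \sum_(a <- A) (w + a == w + w) = 0.
Proof.
move=> wA; rewrite big_seq big1 // => a aA; rewrite eqn_add2l; case: eqP => // aw.
by rewrite aw (negbTE wA) in aA.
Qed.

Lemma rich_cons (w d : nat) : w \notin A -> rich (w :: A) d <= rich A d + newly_rich A w d.
Proof.
move=> wA; rewrite /rich sums2_cons; case: (ltnP 2 (sums2 A d)) => [_|s_le].
  by case: ltnP.
rewrite /newly_rich big_cons -big_distrl /=.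
have [<-|_] := eqVneq (w + w) d.
  by rewrite shift_double_eq0 //; case: ltnP; lia.
(* The new ordered pairs come in twos, so [d] had a representation before. *)
have := shift_le1 w d.
by case: (\sum_(a <- A) _) => [|[|//]]; case: ltnP; lia.
Qed.

Lemma admissible_cons (w : nat) :
  w \notin A -> 0 < w -> ~~ forbidden A w -> admissible (w :: A).
Proof.
rewrite negb_or => wA w_gt0 /andP[/hasPn poorA poorw]; split.
- by rewrite /= wA.
- by case: adm => _ A0 _; rewrite inE negb_or eq_sym -lt0n w_gt0.
move=> n; rewrite sums2_cons; have s1 := shift_le1 w n; have s4 := A4 n.
have [def_n|_] := eqVneq (w + w) n.
  move: poorw; rewrite /rich def_n -leqNgt.
  by rewrite -def_n shift_double_eq0 //; lia.
have [/hasP[a aA /eqP def_n]|/hasPn none] := boolP (has (fun a => w + a == n) A).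
  by move: (poorA a aA); rewrite /rich def_n -leqNgt; lia.
by rewrite [X in 2 * X]big_seq big1 => [|a /none/negbTE->]; lia.
Qed.

Lemma rich_weight d :
  rich A d <= \sum_(a <- A) \sum_(b <- A) (a + b == d) * rich A (a + b).
Proof.
rewrite /rich; case: (ltnP 2 (sums2 A d)) => // d_rich.
apply: leq_trans (ltnW (ltnW d_rich)) _.
apply: leq_sum => a _; apply: leq_sum => b _.
by case: eqP => // ->; rewrite d_rich.
Qed.

(** An injective family of integers meets the rich ones at most [rich_pairs]
    times. *)
Lemma sum_rich_le (s : seq nat) (phi : nat -> nat) :
  {in A & A, forall a b, \sum_(w <- s) (a + b == phi w) <= 1} ->
  \sum_(w <- s) rich A (phi w) <= rich_pairs A.
Proof.
move=> inj; apply: leq_trans (leq_sum _ (fun w _ => rich_weight (phi w))) _.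
rewrite exchange_big /=; apply: leq_sum_seq => a aA.
rewrite exchange_big /=; apply: leq_sum_seq => b bA.
by rewrite -big_distrl /=; case: rich; rewrite ?muln0 // muln1 inj.
Qed.

Lemma sum_sums2_shift n : \sum_(v <- A) sums2 A (n - v) <= sums3 A n.
Proof.
apply: leq_sum_seq => v vA; apply: leq_sum_seq => a aA; apply: leq_sum_seq => b bA.
have := A_gt0 aA; case: eqP => // def_d a0; suff -> : v + (a + b) == n by [].
lia.
Qed.

Lemma sums3_inc n w :
  sums3 (w :: A) n - sums3 A n
  = 3 * \sum_(a <- A) \sum_(b <- A) (w + (a + b) == n)
    + 3 * \sum_(a <- A) (w + (w + a) == n) + (w + (w + w) == n).
Proof. rewrite sums3_cons; lia. Qed.

(** Each new representation contains [w]; what remains is counted by [sums2 A]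
    or is determined. *)
Lemma sums3_inc_le n w : sums3 (w :: A) n - sums3 A n <= 16.
Proof.
rewrite sums3_inc.
have h1 : \sum_(a <- A) \sum_(b <- A) (w + (a + b) == n) <= 4.
  apply: leq_trans (A4 (n - w)); apply: leq_sum => a _; apply: leq_sum => b _.
  by case: eqP => // <-; rewrite addKn eqxx.
have h2 : \sum_(a <- A) (w + (w + a) == n) <= 1.
  by apply: (@sum_le1 A (fun a => w + (w + a) == n)) => // i j _ _ /eqP + /eqP; lia.
by case: eqP; lia.
Qed.

(** Given the other two summands, [w] is determined. *)
Lemma sums3_inc_sum (n : nat) (s : seq nat) : uniq s ->
  \sum_(w <- s) (sums3 (w :: A) n - sums3 A n) <= 3 * m ^ 2 + 3 * m + 1.
Proof.
move=> us; under eq_bigr => w _ do rewrite sums3_inc.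
rewrite big_split /= big_split /= -!big_distrr /= -mulnn.
have h1 : \sum_(w <- s) \sum_(a <- A) \sum_(b <- A) (w + (a + b) == n) <= m * (m * 1).
  apply: exchange_sum2_le => a b _ _.
  by apply: (@sum_le1 s (fun w => w + (a + b) == n)) => // i j _ _ /eqP + /eqP; lia.
have h2 : \sum_(w <- s) \sum_(a <- A) (w + (w + a) == n) <= m * 1.
  apply: exchange_sum_le => a _.
  by apply: (@sum_le1 s (fun w => w + (w + a) == n)) => // i j _ _ /eqP + /eqP; lia.
have h3 : \sum_(w <- s) (w + (w + w) == n) <= 1.
  by apply: (@sum_le1 s (fun w => w + (w + w) == n)) => // i j _ _ /eqP + /eqP; lia.
rewrite !muln1 in h1 h2.
exact: leq_add (leq_add (leq_mul (leqnn 3) h1) (leq_mul (leqnn 3) h2)) h3.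
Qed.

Lemma newly_rich_le (w d : nat) :
  newly_rich A w d <= 4 * (\sum_(x <- A) (w + x == d) + (w + w == d)).
Proof.
rewrite /newly_rich -big_distrl /= big_cons [X in X * _]addnC mulnC leq_mul2r.
by rewrite A4 orbT.
Qed.

Lemma rich_pairs_inc (w : nat) : w \notin A ->
  rich_pairs (w :: A) - rich_pairs A <= 8 * \sum_(x <- w :: A) sums2 A (w + x).
Proof.
move=> wA; set S := \sum_(x <- w :: A) _.
have old : \sum_(a <- A) \sum_(b <- A) rich (w :: A) (a + b) <= rich_pairs A + 4 * S.
  apply: (@leq_trans (\sum_(a <- A) \sum_(b <- A) (rich A (a + b) + newly_rich A w (a + b)))).
    by apply: leq_sum => a _; apply: leq_sum => b _; exact: rich_cons.
  under eq_bigr => a _ do rewrite big_split /=.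
  rewrite big_split /= leq_add2l /newly_rich.
  under eq_bigr => a _ do rewrite exchange_big /=.
  rewrite exchange_big /= big_distrr /=; apply: leq_sum => x _.
  apply: (@leq_trans (\sum_(a <- A) \sum_(b <- A) (a + b == w + x) * 4)).
    by apply: leq_sum => a _; apply: leq_sum => b _; rewrite eq_sym leq_mul2l A4 orbT.
  under eq_bigr => a _ do rewrite -big_distrl /=.
  by rewrite -big_distrl /= mulnC.
have new : {in w :: A, forall x, rich (w :: A) (w + x) <= 2 * sums2 A (w + x)}.
  move=> x xA; apply: leq_trans (rich_cons _ wA) _.
  rewrite /newly_rich -big_distrl /= mul2n -addnn leq_add ?rich_le //.
  rewrite -[leqRHS]mul1n leq_mul2r; apply/orP; right.
  apply: (@sum_le1 (w :: A) (fun y => w + y == w + x)); first by rewrite /= wA.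
  by move=> i j _ _ /eqP + /eqP; lia.
have {}new := leq_sum_seq new; rewrite -big_distrr /= in new.
have -> : rich_pairs (w :: A) = \sum_(a <- A) \sum_(b <- A) rich (w :: A) (a + b)
   + \sum_(x <- w :: A) rich (w :: A) (w + x) + \sum_(x <- A) rich (w :: A) (w + x).
  rewrite /rich_pairs [LHS]big_cons.
  under [X in _ + X = _]eq_bigr => a _ do rewrite big_cons [a + w]addnC.
  rewrite big_split /=; lia.
have : \sum_(x <- A) rich (w :: A) (w + x) <= \sum_(x <- w :: A) rich (w :: A) (w + x).
  by rewrite [leqRHS]big_cons leq_addl.
lia.
Qed.

Lemma rich_pairs_inc_le (w : nat) : w \notin A ->
  rich_pairs (w :: A) - rich_pairs A <= 32 * m.+1.
Proof.
move=> wA; apply: leq_trans (rich_pairs_inc wA) _.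
have : \sum_(x <- w :: A) sums2 A (w + x) <= size (w :: A) * 4.
  by apply: sum_le_size => x _.
rewrite /= -/m; lia.
Qed.

Lemma rich_pairs_inc_sum (s : seq nat) : uniq s -> {in s, forall w : nat, w \notin A} ->
  \sum_(w <- s) (rich_pairs (w :: A) - rich_pairs A) <= 8 * (m ^ 3 + m ^ 2).
Proof.
move=> us sA.
apply: (@leq_trans (\sum_(w <- s) 8 * \sum_(x <- w :: A) sums2 A (w + x))).
  by apply: leq_sum_seq => w /sA; exact: rich_pairs_inc.
rewrite -big_distrr /= leq_mul2l /=; under eq_bigr => w _ do rewrite big_cons.
rewrite big_split /= addnC leq_add //.
  have -> : m ^ 3 = m * (m * (m * 1)) by lia.
  apply: exchange_sum_le => x _; apply: exchange_sum2_le => a b _ _.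
  by apply: (@sum_le1 s (fun w => a + b == w + x)) => // i j _ _ /eqP + /eqP; lia.
have -> : m ^ 2 = m * (m * 1) by lia.
apply: exchange_sum2_le => a b _ _.
by apply: (@sum_le1 s (fun w => a + b == w + w)) => // i j _ _ /eqP + /eqP; lia.
Qed.

(** The increment of [rich_shifts A N] splits into: old pairs [u], [v] with a
    newly rich difference; pairs containing [w] once, with a difference that was
    rich or is newly rich; and the pair [w], [w]. *)
Definition shift_new (N w : nat) := \sum_(u <- A) \sum_(v <- A) newly_rich A w (N - (u + v)).
Definition shift_one (N w : nat) := \sum_(u <- A) rich A (N - (w + u)).
Definition shift_one_new (N w : nat) := \sum_(u <- A) newly_rich A w (N - (w + u)).

Lemma rich_shifts_inc (N w : nat) : w \notin A ->
  rich_shifts (w :: A) N - rich_shifts A N <=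
   shift_new N w + 2 * (shift_one N w + shift_one_new N w)
   + rich (w :: A) (N - (w + w)).
Proof.
move=> wA.
have -> : rich_shifts (w :: A) N =
   \sum_(u <- A) \sum_(v <- A) rich (w :: A) (N - (u + v))
   + 2 * (\sum_(u <- A) rich (w :: A) (N - (w + u))) + rich (w :: A) (N - (w + w)).
  rewrite /rich_shifts !big_cons.
  under [X in _ + X = _]eq_bigr => u _ do rewrite big_cons [u + w]addnC.
  rewrite big_split /=; lia.
have old : \sum_(u <- A) \sum_(v <- A) rich (w :: A) (N - (u + v))
           <= rich_shifts A N + shift_new N w.
  rewrite -big_split; apply: leq_sum => u _; rewrite -big_split; apply: leq_sum => v _.
  exact: rich_cons.
have one : \sum_(u <- A) rich (w :: A) (N - (w + u))
           <= shift_one N w + shift_one_new N w.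
  by rewrite -big_split; apply: leq_sum => u _; exact: rich_cons.
lia.
Qed.

(** [N - (u + v) = w + x] exhibits [N - w] as a sum of three elements. *)
Lemma shift_new_le (N w : nat) t : 0 < w -> (forall n, sums3 A n <= t) ->
  shift_new N w <= 4 * t + 16.
Proof.
move=> w0 le_t.
apply: (@leq_trans (\sum_(u <- A) \sum_(v <- A)
   4 * (\sum_(x <- A) (w + x == N - (u + v)) + (w + w == N - (u + v))))).
  by apply: leq_sum => u _; apply: leq_sum => v _; exact: newly_rich_le.
under eq_bigr => u _ do rewrite -big_distrr /= big_split /=.
rewrite -big_distrr /= big_split /= -[16]/(4 * 4) -mulnDr leq_mul2l /= leq_add //.
  apply: leq_trans (le_t (N - w)); apply: leq_sum => u _; apply: leq_sum => v _.
  apply: leq_sum => x _; case: eqP => // def_x.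
  by suff -> : u + (v + x) == N - w by []; lia.
apply: leq_trans (A4 (N - (w + w))); apply: leq_sum => u _; apply: leq_sum => v _.
by case: eqP => // def_w; suff -> : u + v == N - (w + w) by []; lia.
Qed.

(** For given [u], [v], [x] the element [w] is determined, and
    [N - (u + v)] must be a sum of two elements of [A]: the total is [m] times a
    number of representations of [N] as a sum of four, at most [m * t]. *)
Lemma shift_new_sum (N : nat) (s : seq nat) t : uniq s -> (forall n, sums3 A n <= t) ->
  {in s, forall w : nat, 0 < w} -> \sum_(w <- s) shift_new N w <= m.+1 * (m * t).
Proof.
move=> us le_t s0; rewrite /shift_new exchange_big /=.
under eq_bigr => u _ do rewrite exchange_big /=.
have fixed d : \sum_(w <- s) newly_rich A w d <= m.+1 * sums2 A d.
  rewrite /newly_rich; under eq_bigr => w _ do rewrite -big_distrl /=.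
  rewrite -big_distrl /= leq_mul2r; apply/orP; right.
  under eq_bigr => w _ do rewrite big_cons.
  rewrite big_split /= -[m.+1]add1n leq_add //.
    by apply: (@sum_le1 s (fun w => w + w == d)) => // i j _ _ /eqP + /eqP; lia.
  rewrite -[leqRHS]muln1; apply: exchange_sum_le => x _.
  by apply: (@sum_le1 s (fun w => w + x == d)) => // i j _ _ /eqP + /eqP; lia.
apply: (@leq_trans (\sum_(u <- A) \sum_(v <- A) m.+1 * sums2 A (N - (u + v)))).
  by apply: leq_sum => u _; apply: leq_sum => v _; exact: fixed.
under eq_bigr => u _ do rewrite -big_distrr /=.
rewrite -big_distrr /= leq_mul2l /=; apply: sum_le_size => u _.
apply: leq_trans (le_t (N - u)); apply: leq_trans (sum_sums2_shift (N - u)).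
by apply: leq_sum => v _; rewrite subnDA.
Qed.

Lemma shift_one_le (N w : nat) t : (forall n, sums3 A n <= t) -> shift_one N w <= t.
Proof.
move=> le_t; apply: leq_trans (le_t (N - w)); apply: leq_trans (sum_sums2_shift _).
by apply: leq_sum => u _; rewrite subnDA rich_le.
Qed.

Lemma shift_one_sum (N : nat) (s : seq nat) : uniq s ->
  \sum_(w <- s) shift_one N w <= m * rich_pairs A.
Proof.
move=> us; apply: exchange_sum_le => u _; apply: sum_rich_le => a b aA _.
apply: (@sum_le1 s (fun w => a + b == N - (w + u))) => // i j _ _.
by move=> /eqP + /eqP; have := A_gt0 aA; lia.
Qed.

Lemma shift_one_new_le (N w : nat) : 0 < w -> shift_one_new N w <= 20.
Proof.
move=> w0; apply: (@leq_trans (\sum_(u <- A)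
   4 * (\sum_(x <- A) (w + x == N - (w + u)) + (w + w == N - (w + u))))).
  by apply: leq_sum => u _; exact: newly_rich_le.
rewrite -big_distrr /= big_split /= -[20]/(4 * (4 + 1)) leq_mul2l /= leq_add //.
  apply: leq_trans (A4 (N - (w + w))); apply: leq_sum => u _; apply: leq_sum => x _.
  by case: eqP => // def_x; suff -> : u + x == N - (w + w) by []; lia.
apply: (@sum_le1 A (fun u => w + w == N - (w + u))) => // i j _ _ /eqP + /eqP; lia.
Qed.

Lemma shift_one_new_sum (N : nat) (s : seq nat) : uniq s -> {in s, forall w : nat, 0 < w} ->
  \sum_(w <- s) shift_one_new N w <= 4 * (m ^ 2 + m).
Proof.
move=> us s0; apply: (@leq_trans (\sum_(w <- s) \sum_(u <- A)
   4 * (\sum_(x <- A) (w + x == N - (w + u)) + (w + w == N - (w + u))))).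
  by apply: leq_sum => w _; apply: leq_sum => u _; exact: newly_rich_le.
under eq_bigr => w _ do rewrite -big_distrr /= big_split /=.
rewrite -big_distrr /= big_split /= leq_mul2l /= leq_add //.
  have -> : m ^ 2 = m * (m * 1) by lia.
  apply: exchange_sum2_le => u x _ _.
  apply: (@sum_le1 s (fun w => w + x == N - (w + u))) => // i j /s0 + /s0 + /eqP + /eqP.
  lia.
rewrite -[leqRHS]muln1; apply: exchange_sum_le => u _.
apply: (@sum_le1 s (fun w => w + w == N - (w + u))) => // i j /s0 + /s0 + /eqP + /eqP.
lia.
Qed.

Lemma rich_twice_sum (N : nat) (s : seq nat) :
  uniq s -> {in s, forall w : nat, 0 < w /\ w \notin A} ->
  \sum_(w <- s) rich (w :: A) (N - (w + w)) <= rich_pairs A + 4 * m.+1.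
Proof.
move=> us sA; apply: (@leq_trans (\sum_(w <- s)
   (rich A (N - (w + w)) + 4 * (\sum_(x <- A) (w + x == N - (w + w))
                                + (w + w == N - (w + w)))))).
  apply: leq_sum_seq => w /sA[_ wA]; apply: leq_trans (rich_cons _ wA) _.
  by rewrite leq_add2l newly_rich_le.
rewrite big_split /= leq_add //.
  apply: sum_rich_le => a b aA _.
  apply: (@sum_le1 s (fun w => a + b == N - (w + w))) => // i j _ _ /eqP + /eqP.
  by have := A_gt0 aA; lia.
rewrite -big_distrr /= leq_mul2l /= big_split /= -[m.+1]addn1 leq_add //.
  rewrite -[leqRHS]muln1; apply: exchange_sum_le => x _.
  apply: (@sum_le1 s (fun w => w + x == N - (w + w))) => // i j /sA[+ _] /sA[+ _] /eqP + /eqP.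
  lia.
apply: (@sum_le1 s (fun w => w + w == N - (w + w))) => // i j /sA[+ _] /sA[+ _] /eqP + /eqP.
lia.
Qed.

Lemma rich_shifts_inc_le (N w : nat) t : w \notin A -> 0 < w -> (forall n, sums3 A n <= t) ->
  rich_shifts (w :: A) N - rich_shifts A N <= 6 * t + 57.
Proof.
move=> wA w0 le_t; apply: leq_trans (rich_shifts_inc N wA) _.
have := shift_new_le N w0 le_t; have := shift_one_le N w le_t.
have := shift_one_new_le N w0; have := leq_b1 (rich (w :: A) (N - (w + w))); lia.
Qed.

Lemma rich_shifts_inc_sum (N : nat) (s : seq nat) t :
  uniq s -> {in s, forall w : nat, 0 < w /\ w \notin A} ->
  (forall n, sums3 A n <= t) ->
  \sum_(w <- s) (rich_shifts (w :: A) N - rich_shifts A N) <=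
    m.+1 * (m * t) + (2 * m).+1 * rich_pairs A + 8 * (m ^ 2 + m) + 4 * m.+1.
Proof.
move=> us sA le_t.
have s0 : {in s, forall w : nat, 0 < w} by move=> w /sA[].
apply: (@leq_trans (\sum_(w <- s) (shift_new N w
   + 2 * (shift_one N w + shift_one_new N w) + rich (w :: A) (N - (w + w))))).
  by apply: leq_sum_seq => w /sA[_ wA]; exact: rich_shifts_inc.
rewrite big_split /= big_split /= -big_distrr /= big_split /=.
have := shift_new_sum N us le_t s0; have := shift_one_sum N us.
have := shift_one_new_sum N us s0; have := rich_twice_sum N us sA; nia.
Qed.

Lemma forbidden_le (w : nat) : forbidden A w <= \sum_(a <- A) rich A (w + a) + rich A (w + w).
Proof.
rewrite /forbidden; have [/hasP[a aA ra]|_] := boolP (has _ A).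
  by rewrite (perm_big _ (perm_to_rem aA)) big_cons ra.
exact: leq_addl.
Qed.

Lemma sum_rich_double (s : seq nat) : uniq s -> \sum_(w <- s) rich A (w + w) <= rich_pairs A.
Proof.
move=> us; apply: sum_rich_le => a b _ _.
by apply: (@sum_le1 s (fun w => a + b == w + w)) => // i j _ _ /eqP + /eqP; lia.
Qed.

Lemma forbidden_sum (s : seq nat) : uniq s ->
  \sum_(w <- s) forbidden A w <= m.+1 * rich_pairs A.
Proof.
move=> us; apply: leq_trans (leq_sum _ (fun w _ => forbidden_le w)) _.
rewrite big_split /= mulSn addnC leq_add ?sum_rich_double //.
apply: exchange_sum_le => x _; apply: sum_rich_le => a b _ _.
by apply: (@sum_le1 s (fun w => a + b == w + x)) => // i j _ _ /eqP + /eqP; lia.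
Qed.

Definition allowed (s : seq nat) : seq nat :=
  [seq w <- s | (w \notin A) && ~~ forbidden A w].

Lemma mem_sum_le (s : seq nat) : uniq s -> \sum_(w <- s) (w \in A) <= m.
Proof.
move=> us; rewrite -(muln1 m).
apply: leq_trans (_ : \sum_(w <- s) \sum_(a <- A) (w == a) <= _).
  apply: leq_sum => w _; have [wA|//] := boolP (w \in A).
  by rewrite (perm_big _ (perm_to_rem wA)) big_cons eqxx.
apply: exchange_sum_le => a _.
by apply: (@sum_le1 s (fun w => w == a)) => // i j _ _ /eqP-> /eqP->.
Qed.

Lemma size_allowed (s : seq nat) : uniq s ->
  size s <= size (allowed s) + m + m.+1 * rich_pairs A.
Proof.
move=> us; have := forbidden_sum us; have := mem_sum_le us.
suff : size s <= size (allowed s) + \sum_(w <- s) (w \in A)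
                 + \sum_(w <- s) forbidden A w by lia.
have -> : size (allowed s) = \sum_(w <- s) ((w \notin A) && ~~ forbidden A w).
  rewrite size_filter -sum1_count big_mkcond /=.
  by apply: eq_bigr => w _; case: (_ && _).
rewrite -[size s]sum1_size -!big_split /=.
by apply: leq_sum => w _; case: (w \in A); case: forbidden.
Qed.

(** The covering lemma: of the [size C ^ 2] pairs of the core, each giving one
    candidate [n - (u + v)] (at most four times the same), only those are lost
    whose candidate lies in [A] or is forbidden. *)
Lemma hits_lower (C s : seq nat) (n g : nat) : subseq C A -> uniq s ->
  (forall N, rich_shifts A N <= g) ->
  {in C & C, forall u v, n - (u + v) \in s /\ u + v <= n} ->
  size C ^ 2 <= 4 * count (fun w => 0 < sums2 C (n - w)) (allowed s)
                + 4 * m + m * g + 4 * rich_pairs A.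
Proof.
move=> CA us le_g ns.
have C4 d : sums2 C d <= 4 by apply: leq_trans (A4 d); exact: sums2_subseq.
have total : size C ^ 2 <= \sum_(w <- s) sums2 C (n - w).
  rewrite /sums2 exchange_big /=; under eq_bigr => u _ do rewrite exchange_big /=.
  rewrite -mulnn -[X in X * _]sum1_size big_distrl /=; apply: leq_sum_seq => u uC.
  rewrite mul1n -sum1_size; apply: leq_sum_seq => v vC.
  have [ws le_n] := ns u v uC vC.
  by rewrite (perm_big _ (perm_to_rem ws)) big_cons subKn // eqxx.
apply: leq_trans total _.
have bad : \sum_(w <- s) forbidden A w * sums2 C (n - w) <= m * g + 4 * rich_pairs A.
  apply: (@leq_trans (\sum_(w <- s) (\sum_(a <- A) rich A (w + a) * sums2 A (n - w)
                                     + 4 * rich A (w + w)))).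
    apply: leq_sum => w _; apply: leq_trans (leq_mul (forbidden_le w) (leqnn _)) _.
    rewrite mulnDl leq_add //; last by rewrite mulnC leq_mul2r C4 orbT.
    by rewrite -big_distrl leq_mul2l sums2_subseq ?orbT.
  rewrite big_split /= -big_distrr /= leq_add ?leq_mul2l ?sum_rich_double //.
  apply: exchange_sum_le => a _; apply: leq_trans (le_g (n + a)).
  under eq_bigr => w _ do rewrite big_distrr /=.
  rewrite exchange_big /=; apply: leq_sum_seq => u uA'.
  under eq_bigr => w _ do rewrite big_distrr /=.
  rewrite exchange_big /=; apply: leq_sum_seq => v vA.
  apply: (@leq_trans (\sum_(w <- s) (u + v == n - w) * rich A (n + a - (u + v)))).
    apply: leq_sum => w _; case: eqP; rewrite ?muln0 // muln1 mul1n => def_w.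
    suff -> : n + a - (u + v) = w + a by [].
    have := A_gt0 uA'; lia.
  rewrite -big_distrl /=; case: rich; rewrite ?muln0 // muln1.
  apply: (@sum_le1 s (fun w => u + v == n - w)) => // i j _ _ /eqP + /eqP.
  by have := A_gt0 uA'; lia.
have old : \sum_(w <- s) (w \in A) * sums2 C (n - w) <= 4 * m.
  apply: (@leq_trans (\sum_(w <- s) (w \in A) * 4)).
    by apply: leq_sum => w _; rewrite leq_mul2l C4 orbT.
  by rewrite -big_distrl /= mulnC leq_mul2l mem_sum_le.
suff : \sum_(w <- s) sums2 C (n - w) <= 
       \sum_(w <- s) 4 * ((0 < sums2 C (n - w)) && ((w \notin A) && ~~ forbidden A w))
       + \sum_(w <- s) (w \in A) * sums2 C (n - w)
       + \sum_(w <- s) forbidden A w * sums2 C (n - w).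
  move=> split3; apply: leq_trans split3 _.
  rewrite -[leqRHS]addnA; apply: leq_add; last exact: bad.
  rewrite leq_add // -big_distrr leq_mul2l /= count_filter -sum1_count [leqRHS]big_mkcond /=.
  by apply: leq_sum => w _; case: (_ && _).
rewrite -!big_split /=; apply: leq_sum => w _; have := C4 (n - w).
by case: (w \in A); case: forbidden; case: (posnP (sums2 C _)) => /=; lia.
Qed.

End Counters.

(** * One stage of the construction *)

Lemma absorb (q c i j : nat) : c <= q -> i < j -> c * q ^ i <= q ^ j.
Proof.
move=> cq ij; case: (posnP q) => [q0|q_gt0].
  by move: cq; rewrite q0 leqn0 => /eqP->; rewrite mul0n.
apply: (@leq_trans (q ^ i.+1)); first by rewrite expnS leq_mul2r cq orbT.
by rewrite leq_pexp2l.
Qed.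

(* Powers are abstracted first, so that the arithmetic is linear in them. *)
Ltac pow_lia :=
  repeat match goal with |- context [expn ?a ?n] => generalize (expn a n) end;
  clear; lia.

(** What a stage with parameter [q] leaves behind.  The bounds are stated with
    [2 * q], the parameter of the next stage; this doubling absorbs everything
    that a stage adds to them. *)
Definition stage_inv (q : nat) (A : seq nat) : Prop :=
  [/\ admissible A /\ {in A, forall a : nat, a < q ^ 60},
      size A <= (2 * q) ^ 21,
      forall n, sums3 A n <= (2 * q) ^ 5,
      forall N, rich_shifts A N <= (2 * q) ^ 10
    & rich_pairs A <= (2 * q) ^ 26].

(** The three families of quantities controlled by the potential, indexed by one
    type so that a single list enumerates them. *)
Definition counter (j : option (bool * nat)) (A : seq nat) : nat :=
  match j with
  | Some (true, n) => sums3 A n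
  | Some (false, N) => rich_shifts A N
  | None => rich_pairs A
  end.

Definition counters (R : nat) : seq (option (bool * nat)) :=
  None :: [seq Some (b, n) | b <- [:: true; false], n <- iota 0 R].

Lemma mem_counters R b n : n < R -> Some (b, n) \in counters R.
Proof.
move=> nR; rewrite in_cons; apply/orP; right; apply/allpairsP; exists (b, n); split=> //=.
  by case: b.
by rewrite mem_iota add0n.
Qed.

Lemma size_counters R : size (counters R) = (2 * R).+1.
Proof. by rewrite /counters /= cats0 size_cat !size_map size_iota addnn mul2n. Qed.

Lemma sums3_big A X n : {in A, forall a : nat, a < X} -> 4 * X <= n -> sums3 A n = 0.
Proof.
move=> lt_X le_n; rewrite /sums3 big_seq big1 // => c cA.
rewrite big_seq big1 // => a aA; rewrite big_seq big1 // => b bA.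
have := lt_X _ cA; have := lt_X _ aA; have := lt_X _ bA.
by case: eqP => //; lia.
Qed.

Lemma rich_shifts_big A X N : {in A, forall a : nat, a < X} -> 4 * X <= N ->
  rich_shifts A N = 0.
Proof.
move=> lt_X le_n; rewrite /rich_shifts big_seq big1 // => u uA.
rewrite big_seq big1 // => v vA; rewrite /rich.
suff -> : sums2 A (N - (u + v)) = 0 by [].
have := lt_X _ uA; have := lt_X _ vA => ltv ltu.
apply/eqP; rewrite -leqn0 leqNgt; apply/negP => /sums2_gt0[a [b [aA bA]]].
by have := lt_X _ aA; have := lt_X _ bA; lia.
Qed.

(** Beyond [4 * X] the counters vanish, so finitely many of them control all. *)
Lemma counters_bound A X tau gam : {in A, forall a : nat, a < X} ->
  (forall j, j \in counters (4 * X) -> counter j A <=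
     match j with Some (true, _) => tau | Some (false, _) => gam
                | None => rich_pairs A end) ->
  (forall n, sums3 A n <= tau) /\ (forall N, rich_shifts A N <= gam).
Proof.
move=> lt_X le_cnt; split=> n; have [nX|Xn] := ltnP n (4 * X).
- exact: le_cnt _ (mem_counters true nX).
- by rewrite (sums3_big lt_X Xn).
- exact: le_cnt _ (mem_counters false nX).
by rewrite (rich_shifts_big lt_X Xn).
Qed.

Section Stage.

(* Comparing powers such as [q ^ 47] and [q ^ 60] by conversion would unfold
   them into products. *)
Local Opaque expn.

Variables (q2 q1 q : nat) (C A0 ns : seq nat).
Hypothesis q1_def : q1 = 2 * q2.
Hypothesis q_def : q = 2 * q1.
Hypothesis q2_big : 2 ^ 42 <= q2.
Hypothesis exp_big : q ^ 60 * 16 + 2 < 2 ^ q.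
Hypothesis inv0 : stage_inv q1 A0.
Hypothesis subC : subseq C A0.
Hypothesis size_ns : size ns <= q ^ 60.
Hypothesis core_ok : forall n, n \in ns ->
  [/\ q2 ^ 21 <= size C, {in C, forall c : nat, c < q2 ^ 60} & q1 ^ 60 <= n < q ^ 60].

Definition stage_P (A : seq nat) : Prop :=
  [/\ admissible A, {in A, forall a : nat, a < q ^ 60} & subseq C A].

(** Bounds for twice the increment of a counter in one step, which is at most
    16, [6 t + 57] with [t <= 2 q ^ 5], or [32 (m + 1)] with [m <= 2 q ^ 21]. *)
Definition increment_scale (j : option (bool * nat)) : nat :=
  match j with
  | Some (true, _) => 32
  | Some (false, _) => 26 * q ^ 5
  | None => 130 * q ^ 21
  end.

Definition stage_start (j : option (bool * nat)) : nat :=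
  match j with
  | Some (true, _) => q ^ 5
  | Some (false, _) => q ^ 10
  | None => q ^ 26
  end.

Definition stage_hit (n w : nat) : bool := 0 < sums2 C (n - w).

Let range := iota 1 (q ^ 60).-1.

Let q_big : 1000 <= q.
Proof.
have : 2 ^ 10 <= q2 by apply: leq_trans q2_big; rewrite leq_exp2l.
by rewrite q_def q1_def; clear; lia.
Qed.

Let q_pos : 0 < q. Proof. by apply: leq_trans q_big. Qed.
Let pow_gt0 i : 0 < q ^ i. Proof. by rewrite expn_gt0 q_pos. Qed.

Let absorb_const c i j : c <= 1000 -> i < j -> c * q ^ i <= q ^ j.
Proof. by move=> c_le; apply: absorb; apply: leq_trans q_big. Qed.

Lemma stage_bounds A : {in A, forall a : nat, a < q ^ 60} ->
  (forall j, j \in counters (4 * q ^ 60) ->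
     counter j A <= stage_start j + (2 * q ^ 4) * increment_scale j) ->
  [/\ forall n, sums3 A n <= 2 * q ^ 5,
      forall N, rich_shifts A N <= 2 * q ^ 10 & rich_pairs A <= 2 * q ^ 26].
Proof.
move=> lt_X le_cnt.
have [|t g] := @counters_bound A (q ^ 60) (2 * q ^ 5) (2 * q ^ 10) lt_X.
  move=> [[[] n]|] // /le_cnt /= /leq_trans; apply; rewrite [leqRHS]mul2n -addnn leq_add2l.
    have := @absorb_const 64 4 5 isT isT; pow_lia.
  rewrite mulnACA -expnD /=.
  exact: absorb_const.
split=> //; apply: leq_trans (le_cnt None _) _ => //=.
rewrite [leqRHS]mul2n -addnn leq_add2l mulnACA -expnD /=.
exact: absorb_const.
Qed.

(** The mean increments over the [X = q ^ 60]
    candidates have order [q ^ 42], [q ^ 47] and [q ^ 63] divided by [X];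
    relative to the increment scales each of them is below [q ^- 17 / 4].  The
    loss [m * rich_shifts], of order [q ^ 31], is negligible against the
    [q2 ^ 42] pairs of the core, and these are at least [8 * X / q ^ 20]. *)
Lemma stage_step A : stage_P A -> size A <= size A0 + q ^ 21 ->
  (forall j, j \in counters (4 * q ^ 60) ->
     counter j A <= stage_start j + (2 * q ^ 4) * increment_scale j) ->
  let G := allowed A range in
  [/\ 0 < size G,
      forall w, w \in G -> stage_P (w :: A),
      forall j w, j \in counters (4 * q ^ 60) -> w \in G ->
        2 * (counter j (w :: A) - counter j A) <= increment_scale j,
      forall j, j \in counters (4 * q ^ 60) ->
        4 * q ^ 17 * (\sum_(w <- G) (counter j (w :: A) - counter j A))
          <= increment_scale j * size G
    & forall n, n \in ns -> ~~ has (stage_hit n) A ->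
        size G <= q ^ 20 * count (stage_hit n) G].
Proof.
move=> [admA lt_X CA] sizeA /(stage_bounds lt_X)[t_le g_le d_le] G.
have m_le : size A <= 2 * q ^ 21.
  apply: leq_trans sizeA _; rewrite mul2n -addnn leq_add2r.
  by case: inv0 => _ + _ _ _; rewrite -q_def.
set m := size A in m_le.
have u_range : uniq range by rewrite iota_uniq.
have GP w : w \in G -> [/\ w \notin A, ~~ forbidden A w & 0 < w < q ^ 60].
  rewrite mem_filter mem_iota => /andP[/andP[wA fA]].
  by move: (pow_gt0 60) => X_gt0; rewrite add1n prednK // => ?; split.
have uG : uniq G by rewrite filter_uniq.
have mem_G : {in G, forall w : nat, 0 < w /\ w \notin A}.
  by move=> w /GP[wA _ /andP[w0 _]].
have nA_G : {in G, forall w : nat, w \notin A} by move=> w /mem_G[].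
have E i j : q ^ i * q ^ j = q ^ (i + j) by rewrite expnD.
have m1_le : m.+1 <= 3 * q ^ 21 by move: m_le (pow_gt0 21); pow_lia.
have m2_le : m ^ 2 <= 4 * q ^ 42.
  by have := leq_mul m_le m_le; rewrite mulnACA E mulnn.
have m3_le : m ^ 3 <= 8 * q ^ 63.
  by have := leq_mul m_le m2_le; rewrite mulnACA E -expnS.
have md_le : m.+1 * rich_pairs A <= 6 * q ^ 47.
  by have := leq_mul m1_le d_le; rewrite mulnACA E.
have md2_le : (2 * m).+1 * rich_pairs A <= 10 * q ^ 47.
  have m5 : (2 * m).+1 <= 5 * q ^ 21 by move: m_le (pow_gt0 21); pow_lia.
  by have := leq_mul m5 d_le; rewrite mulnACA E.
have mt_le : m.+1 * (m * (2 * q ^ 5)) <= 12 * q ^ 47.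
  have := leq_mul m_le (leqnn (2 * q ^ 5)); rewrite mulnACA E => h.
  by have := leq_mul m1_le h; rewrite mulnACA E.
have mg_le : m * (2 * q ^ 10) <= 4 * q ^ 31.
  by have := leq_mul m_le (leqnn (2 * q ^ 10)); rewrite mulnACA E.
have le_pow i j : i <= j -> q ^ i <= q ^ j by move=> ij; rewrite leq_pexp2l.
have big_G : q ^ 60 <= 2 * size G.
  have := size_allowed admA u_range; rewrite size_iota -/G -/m.
  have := @absorb_const 100 47 60 isT isT.
  have := le_pow 21 47 isT; have := pow_gt0 60; have := pow_gt0 47.
  move: md_le m_le; move: (m.+1 * _); pow_lia.
split.
- by move: big_G (pow_gt0 60); pow_lia.
- move=> w /GP[wA fA /andP[w0 wX]]; split.
  + exact: admissible_cons.
  + by move=> a; rewrite inE => /orP[/eqP->|/lt_X].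
  by apply: subseq_trans CA _; exact: subseq_cons.
- move=> [[[] n]|] w _ /mem_G[w0 wA] /=.
  + have := sums3_inc_le admA n w; pow_lia.
  + have := rich_shifts_inc_le admA n wA w0 t_le.
    have := @absorb_const 57 0 5 isT isT; rewrite expn0; pow_lia.
  have := rich_pairs_inc_le admA wA; rewrite -/m.
  have := @absorb_const 32 0 21 isT isT; rewrite expn0; move: m_le; pow_lia.
- move=> j _; suff avg2 : 8 * q ^ 17 * (\sum_(w <- G) (counter j (w :: A) - counter j A))
          <= increment_scale j * q ^ 60.
    have := leq_trans avg2 (leq_mul (leqnn _) big_G).
    move: (q ^ 17) (size G) (increment_scale j) (\sum_(w <- G) _) => p g y S.
    by rewrite -!mulnA [y * (2 * _)]mulnCA; clear; lia.
  case: j => [[[] n]|] /=.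
  + have := sums3_inc_sum admA n uG; rewrite -/m => le.
    have {}le := leq_trans le (_ : _ <= 19 * q ^ 42).
    apply: (@leq_trans (8 * q ^ 17 * (19 * q ^ 42))).
      rewrite leq_mul2l le ?orbT //.
      have := le_pow 21 42 isT; have := pow_gt0 42; move: m_le m2_le; pow_lia.
    rewrite mulnACA E (leq_trans (_ : _ <= q ^ 60)) //; last by rewrite leq_pmull.
    exact: absorb_const.
  + have le := rich_shifts_inc_sum admA n uG mem_G t_le; rewrite -/m in le.
    apply: (@leq_trans (8 * q ^ 17 * (82 * q ^ 47))).
      rewrite leq_mul2l (leq_trans le) ?orbT //.
      have := le_pow 21 47 isT; have := le_pow 42 47 isT.
      move: md2_le mt_le m1_le m_le m2_le; move: (_ * rich_pairs A) (_ * (m * _)); pow_lia.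
    rewrite mulnACA E -[26 * _ * _]mulnA E (leq_trans (_ : _ <= q ^ 65)) //;
      last by rewrite leq_pmull.
    exact: absorb_const.
  have le := rich_pairs_inc_sum admA uG nA_G; rewrite -/m in le.
  apply: (@leq_trans (8 * q ^ 17 * (96 * q ^ 63))).
    rewrite leq_mul2l (leq_trans le) ?orbT //.
    have := le_pow 42 63 isT; move: m2_le m3_le; pow_lia.
  rewrite mulnACA E -[130 * _ * _]mulnA E (leq_trans (_ : _ <= q ^ 81)) //;
      last by rewrite leq_pmull.
  exact: absorb_const.
move=> n /core_ok[sizeC lt_C /andP[n_ge n_lt]] _.
have q_def2 : q = 4 * q2 by rewrite q_def q1_def mulnA.
have q2_gt0 : 0 < q2 by apply: leq_trans q2_big; rewrite expn_gt0.
have hit_le : size C ^ 2 <= 4 * count (stage_hit n) G + 4 * m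
                            + m * (2 * q ^ 10) + 4 * rich_pairs A.
  apply: hits_lower => // u v uC vC; rewrite mem_iota.
  have u_lt := lt_C u uC; have v_lt := lt_C v vC.
  have uv_lt : u + v < q1 ^ 60.
    rewrite q1_def; apply: (@leq_trans (2 * q2 ^ 60)); first by move: u_lt v_lt; pow_lia.
    by rewrite expnMn leq_mul2r (@leq_pexp2l 2 1 60) ?orbT.
  have [_ A0' _] := admA.
  have u0 : 0 < u.
    rewrite lt0n; apply: contraNneq A0' => <-; exact: (mem_subseq CA).
  by move: uv_lt n_ge n_lt u0; pow_lia.
have sizeC2 : q2 ^ 42 <= size C ^ 2 by have := leq_mul sizeC sizeC; rewrite -expnD mulnn.
(* Both estimates below rest on [2 ^ 42 <= q2], through [2 ^ 68 <= q2 ^ 11] and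
   [2 ^ 83 <= q2 ^ 2]. *)
have loss : 40 * q ^ 31 <= q2 ^ 42.
  rewrite q_def2 expnMn mulnA; apply: (@leq_trans (2 ^ 68 * q2 ^ 31)).
    rewrite leq_mul2r; apply/orP; right; rewrite -[4]/(2 ^ 2) -expnM.
    by apply: (@leq_trans (2 ^ 6 * 2 ^ (2 * 31)));
      [rewrite leq_mul2r orbC|rewrite -expnD leq_exp2l].
  rewrite -[42]/(11 + 31) expnD leq_mul2r; apply/orP; right.
  apply: (@leq_trans ((2 ^ 42) ^ 11)); last by rewrite leq_exp2r.
  by rewrite -expnM leq_exp2l.
have gain : 8 * q ^ 60 <= q ^ 20 * q2 ^ 42.
  rewrite -[60]/(20 + 40) expnD mulnCA leq_mul2l; apply/orP; right.
  rewrite q_def2 expnMn mulnA.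
  have -> : q2 ^ 42 = q2 ^ 2 * q2 ^ 40 by rewrite -expnD.
  rewrite leq_mul2r; apply/orP; right.
  apply: (@leq_trans ((2 ^ 42) ^ 2)); last by rewrite leq_exp2r.
  rewrite -[4]/(2 ^ 2) -[8]/(2 ^ 3) -!expnM -expnD; by rewrite leq_exp2l.
have cnt : q2 ^ 42 <= 8 * count (stage_hit n) G.
  have := le_pow 21 31 isT; have := le_pow 26 31 isT.
  move: hit_le sizeC2 loss d_le m_le mg_le; move: (m * _); pow_lia.
have G_le : size G <= q ^ 60.
  apply: leq_trans (_ : size range <= _); first by rewrite size_filter count_size.
  by rewrite size_iota leq_pred.
have := leq_mul (leqnn (q ^ 20)) cnt; move: gain G_le; rewrite mulnCA.
by move: (q ^ 20 * _) (q ^ 20 * _); pow_lia.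
Qed.

(** With [q ^ 21 = q ^ 17 * q ^ 4] steps of relative growth [q ^- 17 / 2] a counter
    gains a factor [2 ^ (q ^ 4)] at most, which the threshold
    [h = 2 * q ^ 4] beats even after summing over all counters; and
    [q ^ 21 = q ^ 20 * q] steps of hitting probability [q ^- 20] leave a target
    the weight [2 ^- q], which beats the number of targets. *)
Lemma stage : exists W, let A := W ++ A0 in
  [/\ stage_inv q A, q ^ 21 <= size A
    & forall n, n \in ns -> exists a b c,
        [/\ a \in A, b \in A, c \in A & n = a + (b + c)]].
Proof.
have [[adm0 lt0] size0 t0 g0 d0] := inv0; rewrite -q_def in size0 t0 g0 d0.
have q1q : q1 ^ 60 <= q ^ 60 by rewrite leq_exp2r // q_def mul2n -addnn leq_addr.
have P0 : stage_P A0.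
  by split=> // a /lt0 lt; exact: leq_trans lt q1q.
have increment_gt0 j : j \in counters (4 * q ^ 60) -> 0 < increment_scale j.
  by move=> _; case: j => [[[] n]|] //=; rewrite muln_gt0 pow_gt0.
have start_le j : j \in counters (4 * q ^ 60) -> counter j A0 <= stage_start j.
  by move=> _; case: j => [[[] n]|] /=.
have ns_le : 2 * size ns <= 2 ^ q by move: size_ns exp_big; pow_lia.
have js_lt : 2 * (size (counters (4 * q ^ 60)) * 2 ^ (q ^ 4)) < 2 ^ (2 * q ^ 4).
  rewrite [2 * q ^ 4]mul2n -addnn expnD mulnA ltn_pmul2r ?expn_gt0 // size_counters.
  apply: (@leq_trans (2 ^ q)); first by move: exp_big; pow_lia.
  by rewrite leq_exp2l // -[leqLHS]expn1 leq_pexp2l.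
have Lpr : q ^ 21 = q ^ 17 * q ^ 4 by rewrite -expnD.
have Lpr' : q ^ 21 = q ^ 20 * q by rewrite -expnSr.
have [W [sizeW [admA lt_X CA] cnt hits]] :=
  @greedy _ (counters (4 * q ^ 60)) counter increment_scale stage_start ns stage_hit
   (fun A => allowed A range) stage_P A0 (2 * q ^ 4) (q ^ 17) (q ^ 20) (q ^ 4) q (q ^ 21)
   (pow_gt0 17) (pow_gt0 20) increment_gt0 stage_step P0 Lpr Lpr' start_le ns_le js_lt.
exists W; have [t_le g_le d_le] := stage_bounds lt_X cnt.
have dbl i : 0 < i -> 2 * q ^ i <= (2 * q) ^ i.
  move=> i_gt0; rewrite expnMn leq_mul2r; apply/orP; right.
  by rewrite -[leqLHS]expn1 leq_exp2l.
split.
- split=> [||n|N|]; [by []| |exact: leq_trans (t_le n) (dbl 5 isT)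
    |exact: leq_trans (g_le N) (dbl 10 isT)|exact: leq_trans d_le (dbl 26 isT)].
  rewrite size_cat sizeW; apply: leq_trans (dbl 21 isT).
  by rewrite mul2n -addnn leq_add2l.
- by rewrite size_cat sizeW leq_addr.
move=> n n_ns; have /hasP[w wA] := hits n n_ns.
move=> /sums2_gt0[u [v [uC vC def_n]]]; exists w, u, v.
have inA x : x \in C -> x \in W ++ A0 by exact: mem_subseq.
have [_ A0' _] := admA; split; [by []|exact: inA|exact: inA|].
have : u != 0 by apply: contraNneq A0' => <-; exact: inA.
by move: def_n; clear; lia.
Qed.

End Stage.

(** * The union of the chain *)

Section Union.

Local Open Scope classical_set_scope.
Local Open Scope card_scope.

(** Adding the count with the two coordinates exchanged gives all ordered pairs,
    with the diagonal pair, if any, counted twice. *)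
Lemma ordered_sums2 (A : seq nat) n : uniq A ->
  2 * \sum_(a <- A) \sum_(b <- A) ((a <= b) && (a + b == n)) <= sums2 A n + 1.
Proof.
move=> uA; rewrite mul2n -addnn.
rewrite [X in X + _]exchange_big /= -big_split /=.
have diag : \sum_(a <- A) \sum_(b <- A) ((a == b) && (a + b == n)) <= 1.
  apply: (@leq_trans (\sum_(a <- A) (a + a == n))).
    apply: leq_sum_seq => a aA; have [Ea|nEa] := boolP (a + a == n).
      apply: (@sum_le1 A (fun b => (a == b) && (a + b == n))) => //.
      by move=> i j _ _ /andP[/eqP<- _] /andP[/eqP<- _].
    by rewrite big1 // => b _; case: eqP => //= <-; rewrite (negbTE nEa).
  by apply: (@sum_le1 A (fun a => a + a == n)) => // i j _ _ /eqP + /eqP; lia.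
apply: leq_trans (leq_add (leqnn _) diag); rewrite /sums2 -big_split /=.
apply: leq_sum => a _; rewrite -!big_split /=; apply: leq_sum => b _.
rewrite [b + a]addnC; case: (a + b == n); rewrite ?andbF // !andbT.
by case: (ltngtP a b).
Qed.

Lemma admissible_representations (S : set nat) (A : seq nat) n :
  admissible A -> (forall a, a <= n -> S a -> a \in A) ->
  representations S n #<= `I_2.
Proof.
move=> [uA _ A4] SA.
pose L := [seq p <- [seq (a, b) | a <- A, b <- A] | (p.1 <= p.2) && (p.1 + p.2 == n)].
have sizeL : size L <= 2.
  have -> : size L = \sum_(a <- A) \sum_(b <- A) ((a <= b) && (a + b == n)).
    rewrite size_filter -sum1_count big_mkcond big_allpairs_dep /=.
    by apply: eq_bigr => a _; apply: eq_bigr => b _; case: (_ && _).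
  have := ordered_sums2 n uA; have := A4 n; lia.
have repL p : representations S n p -> p \in L.
  case: p => a b [/= Sa Sb ab def_n]; rewrite mem_filter /= ab def_n eqxx /=.
  by rewrite allpairs_f // SA //; lia.
apply/pcard_leP/injfunPex; exists (index^~ L) => [p /repL pL|p p'].
  by rewrite /= (leq_trans _ sizeL) // index_mem.
move=> /set_mem/repL pL /set_mem/repL p'L eq_idx.
by rewrite -(nth_index (0, 0) pL) eq_idx nth_index.
Qed.

End Union.

(** The offset makes [2 ^ 42 <= level i], as the covering estimate requires. *)
Definition level (i : nat) : nat := 2 ^ (i + 42).

Lemma levelS i : level i.+1 = 2 * level i.
Proof. by rewrite /level addSn expnS. Qed.

Lemma pow2_exp_big k : 60 * k + 5 <= 2 ^ k -> (2 ^ k) ^ 60 * 16 + 2 < 2 ^ 2 ^ k.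
Proof.
move=> lin; apply: (@leq_trans (2 ^ (60 * k + 5))); last by rewrite leq_exp2l.
rewrite (expnD 2 (60 * k) 5) (mulnC 60) (expnM 2 k 60).
have : 0 < (2 ^ k) ^ 60 by rewrite !expn_gt0.
by move: ((2 ^ k) ^ 60); clear; lia.
Qed.

Lemma level_exp_big i : level i ^ 60 * 16 + 2 < 2 ^ level i.
Proof.
have lin : 60 * (i + 42) + 5 <= level i.
  elim: i => [|i IHi]; first by rewrite /level add0n; lia.
  by rewrite levelS addSn; lia.
exact: pow2_exp_big lin.
Qed.

(** The state [(C, A)] before stage [i]: the current set and the set one stage
    earlier, which serves as the core.  The chain starts from empty sets, so
    the lower bounds on the sizes hold only after one, respectively two,
    stages. *)
Definition chain_inv (i : nat) (CA : seq nat * seq nat) : Prop :=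
  [/\ stage_inv (level i.+1) CA.2, subseq CA.1 CA.2,
      0 < i -> level i.+1 ^ 21 <= size CA.2
    & 1 < i -> level i ^ 21 <= size CA.1 /\
               {in CA.1, forall c : nat, c < level i ^ 60}].

Definition covers (A : seq nat) (lo hi : nat) : Prop :=
  forall n, lo <= n < hi ->
    exists a b c, [/\ a \in A, b \in A, c \in A & n = a + (b + c)].

Lemma chain_step i CA : chain_inv i CA -> exists A',
  [/\ chain_inv i.+1 (CA.2, A'), subseq CA.2 A'
    & 1 < i -> covers A' (level i.+1 ^ 60) (level i.+2 ^ 60)].
Proof.
case: CA => C A [/= inv CA sizeA core].
pose ns := if 1 < i then iota (level i.+1 ^ 60) (level i.+2 ^ 60 - level i.+1 ^ 60)
           else [::].
have mem_ns n : n \in ns = (1 < i) && (level i.+1 ^ 60 <= n < level i.+2 ^ 60).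
  rewrite /ns; case: ifP => // _; rewrite mem_iota /= subnKC //.
  by rewrite leq_exp2r // [level i.+2]levelS leq_pmull.
have size_ns : size ns <= level i.+2 ^ 60.
  by rewrite /ns; case: ifP => // _; rewrite size_iota leq_subr.
have core_ok n : n \in ns -> [/\ level i ^ 21 <= size C,
    {in C, forall c : nat, c < level i ^ 60} & level i.+1 ^ 60 <= n < level i.+2 ^ 60].
  by rewrite mem_ns => /andP[/core[]].
have level_big : 2 ^ 42 <= level i by rewrite leq_exp2l // leq_addl.
have [W [inv' sizeA' cov]] := stage (levelS i) (levelS i.+1) level_big
  (level_exp_big i.+2) inv CA size_ns core_ok.
exists (W ++ A); split; last by move=> i1 n n_in; apply: cov; rewrite mem_ns i1.
  split=> //= [|i0]; first exact: suffix_subseq.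
  by split; [exact: sizeA|case: inv => [[]]].
exact: suffix_subseq.
Qed.

Lemma chain_exists : exists B : nat -> seq nat,
  [/\ forall i, admissible (B i), forall i, subseq (B i) (B i.+1)
    & forall i, 1 < i -> covers (B i.+1) (level i.+1 ^ 60) (level i.+2 ^ 60)].
Proof.
have step (x : nat * (seq nat * seq nat)) : exists A',
    chain_inv x.1 x.2 -> [/\ chain_inv x.1.+1 (x.2.2, A'), subseq x.2.2 A'
      & 1 < x.1 -> covers A' (level x.1.+1 ^ 60) (level x.1.+2 ^ 60)].
  have [/chain_step[A' HA']|no] := pselect (chain_inv x.1 x.2); first by exists A'.
  by exists [::].
have [F HF] := choice step.
pose st := nat_rect (fun _ => (seq nat * seq nat)%type) ([::], [::])
             (fun i CA => (CA.2, F (i, CA))).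
have inv i : chain_inv i (st i).
  elim: i => [|i IHi]; last by case: (HF (i, st i) IHi).
  split=> //; split=> //=.
  - by split=> //; split=> // n; rewrite /sums2 big_nil.
  - by move=> n; rewrite /sums3 big_nil.
  - by move=> n; rewrite /rich_shifts big_nil.
  by rewrite /rich_pairs big_nil.
exists (fun i => (st i).2); split=> [i|i|i i1].
- by case: (inv i) => [[[]]].
- by case: (HF (i, st i) (inv i)).
by case: (HF (i, st i) (inv i)) => _ _; apply.
Qed.

Local Open Scope classical_set_scope.

Theorem theorem1p2 :
  exists A : set nat,
    [/\ A `<=` positive_integers, B2 2 A & asymptotic_basis 3 A].
Proof.
have [B [admB subB covB]] := chain_exists.
have mono i j : i <= j -> subseq (B i) (B j).
  move=> /subnK <-; elim: (j - i) => [|k IHk] //.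
  by apply: subseq_trans IHk _; exact: subB.
exists [set n | exists i, n \in B i]; split.
- move=> n [i n_B]; rewrite /positive_integers /= lt0n.
  by have [_ B0 _] := admB i; apply: contraNneq B0 => <-.
- move=> n.
  (* A representation of [n] uses elements up to [n] only, and the increasing
     chain has all of these in one [B i]. *)
  have [i Hi] : exists i, forall a, a <= n -> (exists j, a \in B j) -> a \in B i.
    elim: n => [|n [i IHn]].
      exists 0 => a; rewrite leqn0 => /eqP-> [j B0].
      by have [_ + _] := admB j; rewrite B0.
    have [[j nj]|none] := pselect (exists j, n.+1 \in B j); last first.
      exists i => a; rewrite leq_eqVlt => /orP[/eqP->|/IHn //] ex.
      by case: none.
    exists (maxn i j) => a; rewrite leq_eqVlt => /orP[/eqP-> _|/IHn aB /aB].
      by apply: mem_subseq nj; apply: mono; exact: leq_maxr.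
    by apply: mem_subseq; apply: mono; exact: leq_maxl.
  exact: admissible_representations (admB i) Hi.
exists (level 3 ^ 60) => n n_ge.
have [i i1 n_in] : exists2 i, 1 < i & level i.+1 ^ 60 <= n < level i.+2 ^ 60.
  have mono_level j k : j <= k -> level j ^ 60 <= level k ^ 60.
    by move=> jk; rewrite leq_exp2r // leq_exp2l // leq_add2r.
  have ex : exists j, n < level j ^ 60.
    exists n; apply: (@leq_trans (level n)).
      by apply: leq_trans (ltn_expl n (isT : 1 < 2)) _; rewrite leq_exp2l // leq_addr.
    by rewrite -[leqLHS]expn1 leq_pexp2l // expn_gt0.
  (* The least such [j] exceeds 3, because [n] is at least [level 3 ^ 60]. *)
  case: (ex_minnP ex) => j n_lt min_j.
  have j_gt3 : 3 < j.
    rewrite ltnNge; apply/negP => /mono_level j_le.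
    by move: (leq_trans n_lt (leq_trans j_le n_ge)); rewrite ltnn.
  case: j n_lt min_j j_gt3 => [|[|j]] // n_lt min_j j_gt3.
  by exists j => //; rewrite n_lt andbT leqNgt; apply/negP => /min_j; rewrite ltnn.
have [a [b [c [aB bB cB ->]]]] := covB i i1 n n_in.
exists (fun k : 'I_3 => nth 0 [:: a; b; c] k); split.
  by move=> [[|[|[|//]]] k3]; exists i.+1.
by rewrite !big_ord_recl big_ord0 /= addn0.
Qed.
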